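(* For every integer $n\ge 3$, let $s(n)=\sum_{T\in\mathcal{PT}(n)}(-1)^{\mathrm{urc}(T)}$. Then $$s(n)=2\,s(n-1)-2\,s(n-2).$$
   Context: A partition $\lambda=(\lambda_1,\dots,\lambda_r)$ with $\lambda_1\ge\cdots\ge\lambda_r\ge 0$ (zero parts allowed) has Ferrers diagram the left-justified array with $\lambda_i$ cells in row $i$; its length is the total number of rows (including empty rows) and columns. A permutation tableau of length $n$ is a $0,1$-filling of the Ferrers diagram of such a partition, of length $n$, such that (1) each column contains at least one $1$, and (2) no $0$ has simultaneously a $1$ above it in its column and a $1$ to its left in its row. $\mathcal{PT}(n)$ denotes the set of permutation tableaux of length $n$. A $0$ in a permutation tableau is column-restricted if there is a $1$ to its left in the same row. A column is unrestricted if it contains no column-restricted $0$. $\mathrm{urc}(T)$ is the number of unrestricted columns of $T$. *)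

(* Defs.v *)
From mathcomp Require Import all_boot all_order all_algebra.

Set Implicit Arguments.
Unset Strict Implicit.
Unset Printing Implicit Defensive.

Local Open Scope nat_scope.

(* A 0,1-filling of a Ferrers diagram is the sequence of its rows, top to     *)
(* bottom; empty rows are allowed, and the partition is [shape T]. Cells are  *)
(* numbered from 0, and [entry] is [false] outside the diagram, so a zero     *)
(* must be guarded by [in_diagram].                                           *)
Definition filling := seq bitseq.

Definition is_ferrers (T : filling) : bool := sorted geq (shape T).

Definition nrows (T : filling) : nat := size T.
Definition ncols (T : filling) : nat := head 0 (shape T).
Definition tlength (T : filling) : nat := nrows T + ncols T.

Definition in_diagram (T : filling) (i j : nat) : bool := j < nth 0 (shape T) i.
Definition entry (T : filling) (i j : nat) : bool := nth false (nth [::] T i) j.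

Definition is_one (T : filling) (i j : nat) : bool :=
  in_diagram T i j && entry T i j.
Definition is_zero (T : filling) (i j : nat) : bool :=
  in_diagram T i j && ~~ entry T i j.

Definition one_above (T : filling) (i j : nat) : bool :=
  [exists k : 'I_i, is_one T k j].
Definition one_left (T : filling) (i j : nat) : bool :=
  [exists k : 'I_j, is_one T i k].

Definition permutation_tableau (T : filling) : bool :=
  [&& is_ferrers T,
      [forall j : 'I_(ncols T), exists i : 'I_(nrows T), is_one T i j] &
      [forall i : 'I_(nrows T), forall j : 'I_(ncols T),
        is_zero T i j ==> ~~ (one_above T i j && one_left T i j)]].

Definition column_restricted_zero (T : filling) (i j : nat) : bool :=
  is_zero T i j && one_left T i j.

Definition unrestricted_column (T : filling) (j : nat) : bool :=
  [forall i : 'I_(nrows T), ~~ column_restricted_zero T i j].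

Definition urc (T : filling) : nat :=
  #|[set j : 'I_(ncols T) | unrestricted_column T j]|.

(* A tableau of length n has at most n rows, each with at most n cells, so    *)
(* the finite type of bounded sequences below misses none of them: see        *)
(* [PT_complete].                                                             *)
Definition bounded_filling (n : nat) := n.-bseq (n.-bseq bool).

Definition rows n (T : bounded_filling n) : filling :=
  [seq (r : bitseq) | r : n.-bseq bool <- T].

Definition PT (n : nat) : {set bounded_filling n} :=
  [set T | permutation_tableau (rows T) & tlength (rows T) == n].

Definition s (n : nat) : int :=
  (\sum_(T in PT n) (-1) ^+ urc (rows T))%R.

Lemma rows_inj n : injective (@rows n).
Proof. by move=> T U /(inj_map val_inj)/val_inj. Qed.

Lemma PT_complete n (T : filling) :
  permutation_tableau T -> tlength T = n -> exists2 U, U \in PT n & rows U = T.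
Proof.
move=> ptT lenT.
have szT : size T <= n by rewrite -lenT leq_addr.
have rowT : all (fun r : bitseq => size r <= n) T.
  have /and3P[ferT _ _] := ptT.
  have geq_trans : transitive geq by move=> a b c ba cb; apply: leq_trans cb ba.
  move: ferT lenT; rewrite /is_ferrers /tlength /ncols.
  case: (T) => //= r T' pT' <-; rewrite leq_addl /=.
  have := order_path_min geq_trans pT'; rewrite all_map.
  by apply: sub_all => r' /= le_r'r; apply: leq_trans le_r'r (leq_addl _ _).
have [V defV] : exists V : seq (n.-bseq bool), map val V = T.
  elim: (T) rowT => [|r T' IH] /=; first by exists [::].
  by case/andP=> le_rn /IH[V <-]; exists (Bseq le_rn :: V).
have szV : size V <= n by rewrite -defV size_map in szT.
by exists (Bseq szV); rewrite ?inE /rows /= defV ?ptT ?lenT /=.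
Qed.

(* Main.v *)
(* A permutation tableau is built from its south-west corner by repeatedly    *)
(* adding an empty column on the right or a full row on top. Only the word    *)
(* of column states (has a one, has a column-restricted zero) matters:        *)
(* restricted columns must receive a 0 in the new row, and the zeros to the   *)
(* right of the leftmost 1 of that row become column-restricted. The signed   *)
(* count of completed tableaux is then the iterate T^n Phi at the empty word, *)
(* where Phi is the sign of a finished word, zero if some column has no one,  *)
(* and T sums a function over all one-step extensions of a word. At -1 the    *)
(* sums cancel enough that T (T Phi) = 2 T Phi - 2 Phi holds on every word.   *)

Require Import Defs.
From mathcomp Require Import all_boot all_order all_algebra.
From mathcomp Require Import ring.

Set Implicit Arguments.
Unset Strict Implicit.
Unset Printing Implicit Defensive.

Import GRing.Theory.

Local Open Scope ring_scope.

(** The functions [word_sign] and [extend word_sign] span a space stable under [extend], on which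
    X^2 = 2X - 2 holds ([extend2_word_sign]). A fresh column can only get its one from the next row,
    so a column followed by a row contributes [- extend word_sign] ([extend_word_sign_rcons]). Two
    successive rows contribute [3 * extend word_sign - 2 * word_sign] ([row_sum_extend_false]); to
    the right of the leftmost 1 of a row the columns contribute independent factors, so these sums
    go column by column. Linearity carries the relation to all iterates, and [s_extend] identifies
    the iterates at the empty word with [s], through the characterization [mem_build] of the
    constructed fillings and the comparison [permutation_tableauE] with tableaux. *)

Definition column_state : Type := (bool * bool)%type.
Notation fresh := (false, false).

(* [l] tells whether the new row already has a 1 to the left of [w]. *)
Fixpoint add_row (l : bool) (w : seq column_state) (r : bitseq) :=
  if w is x :: w' then if r is b :: r' then
    (x.1 || b, x.2 || ~~ b && l) :: add_row (l || b) w' r' else [::] else [::].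

Fixpoint allowed_rows (w : seq column_state) : seq bitseq :=
  if w is x :: w' then
    map (cons false) (allowed_rows w') ++
    (if x.2 then [::] else map (cons true) (allowed_rows w'))
  else [:: [::]].

Definition row_sum (F : seq column_state -> int) l w : int :=
  \sum_(r <- allowed_rows w) F (add_row l w r).

Definition extend (F : seq column_state -> int) w : int :=
  F (rcons w fresh) + row_sum F false w.

Definition col_sign (x : column_state) : int :=
  if x.1 then (if x.2 then 1 else -1) else 0.
Definition word_sign w : int := \prod_(x <- w) col_sign x.

(* The signed count [row_sum word_sign true] of the ways to continue a row to *)
(* the right of its leftmost 1, in product form.                              *)
Definition tail_sign w : int :=
  \prod_(x <- w) (if x.1 == x.2 then (if x.1 then 1 else -1) else 0).
Definition filled w : int := (all (fun x : column_state => x.1) w)%:R.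

(** * Row sums, column by column, and linearity *)

Lemma row_sum_nil F l : row_sum F l [::] = F [::].
Proof. by rewrite /row_sum big_seq1. Qed.

(** A 0 in the first column becomes column-restricted exactly when [l] holds. A 1 requires the
    column to be free of restricted zeros, hence leaves it in state [(true, false)], and puts a 1 to
    the left of all the rest. *)
Lemma row_sum_cons F l x w :
  row_sum F l (x :: w) = row_sum (fun v => F ((x.1, x.2 || l) :: v)) l w
    + (~~ x.2)%:R * row_sum (fun v => F ((true, false) :: v)) true w.
Proof.
rewrite /row_sum /= big_cat big_map /=; congr (_ + _).
  by apply: eq_bigr => r _; rewrite !orbF.
case: x => h [] /=; first by rewrite big_nil mul0r.
by rewrite big_map mul1r; apply: eq_bigr => r _; rewrite /= !orbT.
Qed.

Lemma eq_row_sum F G l w : F =1 G -> row_sum F l w = row_sum G l w.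
Proof. by move=> FG; apply: eq_bigr => r _. Qed.

Lemma row_sum_comb a b F G l w :
  row_sum (fun v => a * F v + b * G v) l w = a * row_sum F l w + b * row_sum G l w.
Proof. by rewrite /row_sum big_split /= -!mulr_sumr. Qed.

Lemma row_sumZ a F l w : row_sum (fun v => a * F v) l w = a * row_sum F l w.
Proof. by rewrite /row_sum mulr_sumr. Qed.

Lemma eq_extend F G : F =1 G -> extend F =1 extend G.
Proof. by move=> FG w; rewrite /extend FG (eq_row_sum _ _ FG). Qed.

Lemma extend_comb a b F G w :
  extend (fun v => a * F v + b * G v) w = a * extend F w + b * extend G w.
Proof. by rewrite /extend row_sum_comb; ring. Qed.

Lemma eq_iter_extend n F G : F =1 G -> iter n extend F =1 iter n extend G.
Proof. by move=> FG; elim: n => //= n; apply: eq_extend. Qed.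

Lemma iter_extend_comb n a b F G w :
  iter n extend (fun v => a * F v + b * G v) w
    = a * iter n extend F w + b * iter n extend G w.
Proof.
elim: n w => //= n IHn w; rewrite (eq_extend IHn); exact: extend_comb.
Qed.

(** * The quadratic relation for [extend] at [word_sign] *)

Lemma word_sign_cons x w : word_sign (x :: w) = col_sign x * word_sign w.
Proof. exact: big_cons. Qed.

Lemma tail_sign_cons x w : tail_sign (x :: w) =
  (if x.1 == x.2 then (if x.1 then 1 else -1) else 0) * tail_sign w.
Proof. exact: big_cons. Qed.

Lemma filled_cons x w : filled (x :: w) = x.1%:R * filled w.
Proof. by rewrite /filled /=; case: x.1; rewrite ?mul1r ?mul0r. Qed.

(** Every 0 now makes its column restricted, so a column in state [(true, false)] gets 1 from a 0
    and -1 from a 1, and cancels. *)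
Lemma row_sum_word_sign_true w : row_sum word_sign true w = tail_sign w.
Proof.
elim: w => [|[h q] w IHw]; first by rewrite row_sum_nil /word_sign /tail_sign !big_nil.
rewrite row_sum_cons tail_sign_cons -IHw.
rewrite !(eq_row_sum _ _ (word_sign_cons _)) !row_sumZ /col_sign.
by case: h; case: q => /=; ring.
Qed.

(** An added empty column has sign 0, so only the added rows remain. *)
Lemma extend_word_signE w : extend word_sign w = row_sum word_sign false w.
Proof.
by rewrite /extend {1}/word_sign -cats1 big_cat big_seq1 /= mulr0 add0r.
Qed.

Lemma extend_word_sign_nil : extend word_sign [::] = 1.
Proof. by rewrite extend_word_signE row_sum_nil /word_sign big_nil. Qed.

Lemma extend_word_sign_cons x w : extend word_sign (x :: w) =
  col_sign x * extend word_sign w - (~~ x.2)%:R * tail_sign w.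
Proof.
rewrite !extend_word_signE row_sum_cons !(eq_row_sum _ _ (word_sign_cons _)).
rewrite !row_sumZ row_sum_word_sign_true orbF -surjective_pairing.
by rewrite mulN1r mulrN.
Qed.

(** The new row must put a 1 in the fresh column, which then has sign -1; being last, this 1
    restricts nothing. *)
Lemma extend_word_sign_rcons w :
  extend word_sign (rcons w fresh) = - extend word_sign w.
Proof.
elim: w => [|x w IHw] /=.
  by rewrite extend_word_sign_cons extend_word_sign_nil /tail_sign big_nil /=; ring.
rewrite !extend_word_sign_cons IHw /tail_sign -cats1 big_cat big_seq1 /=; ring.
Qed.

(** A 1 would leave the state [(true, false)], where [tail_sign] vanishes; so only the zero row
    counts, and it makes every column restricted. *)
Lemma row_sum_tail_sign_true w : row_sum tail_sign true w = filled w.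
Proof.
elim: w => [|[h q] w IHw]; first by rewrite row_sum_nil /tail_sign big_nil.
rewrite row_sum_cons filled_cons -IHw.
rewrite !(eq_row_sum _ _ (tail_sign_cons _)) !row_sumZ.
by case: h; case: q => /=; ring.
Qed.

(** Again only the zero row counts; with no 1 to its left it changes no state. *)
Lemma row_sum_tail_sign_false w : row_sum tail_sign false w = tail_sign w.
Proof.
elim: w => [|[h q] w IHw]; first by rewrite row_sum_nil /tail_sign big_nil.
rewrite row_sum_cons tail_sign_cons -IHw.
rewrite !(eq_row_sum _ _ (tail_sign_cons _)) !row_sumZ.
by case: h; case: q => /=; ring.
Qed.

(** Serves both summands of [row_sum_cons]: [m] is [l] after a 0, while a 1 is the case of state
    [(true, false)] with [m] false. *)
Lemma row_sum_extend_cons l m x w :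
  row_sum (fun v => extend word_sign ((x.1, x.2 || m) :: v)) l w =
    col_sign (x.1, x.2 || m) * row_sum (extend word_sign) l w
    - (~~ (x.2 || m))%:R * row_sum tail_sign l w.
Proof.
rewrite -mulNr -row_sum_comb; apply: eq_row_sum => v.
by rewrite extend_word_sign_cons mulNr.
Qed.

Lemma row_sum_extend_true w :
  row_sum (extend word_sign) true w = 2 * tail_sign w - filled w.
Proof.
elim: w => [|[h q] w IHw].
  by rewrite row_sum_nil extend_word_sign_nil /tail_sign big_nil /filled.
rewrite row_sum_cons row_sum_extend_cons tail_sign_cons filled_cons.
rewrite (row_sum_extend_cons true false (true, false)) row_sum_tail_sign_true IHw.
by rewrite /col_sign; case: h; case: q => /=; ring.
Qed.

(** When the first column is unrestricted, a 1 there gives [- 2 * tail_sign w], the terms [filled w]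
    cancelling, and a 0 gives one more [- tail_sign w]: hence the coefficient 3. The empty word,
    where both functions are 1, then forces -2. *)
Lemma row_sum_extend_false w : row_sum (extend word_sign) false w =
  3 * extend word_sign w - 2 * word_sign w.
Proof.
elim: w => [|x w IHw].
  by rewrite row_sum_nil extend_word_sign_nil /word_sign big_nil.
rewrite row_sum_cons row_sum_extend_cons (row_sum_extend_cons true false (true, false)).
rewrite row_sum_extend_true row_sum_tail_sign_true row_sum_tail_sign_false IHw.
rewrite extend_word_sign_cons word_sign_cons orbF -surjective_pairing.
have -> : col_sign (true, false) = -1 by []; rewrite /=.
ring.
Qed.

Lemma extend2_word_sign w : extend (extend word_sign) w =
  2 * extend word_sign w + (-2) * word_sign w.
Proof.
rewrite {1}/extend extend_word_sign_rcons row_sum_extend_false; ring.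
Qed.

Lemma iter_extend_rec n w : iter n.+2 extend word_sign w =
  2 * iter n.+1 extend word_sign w - 2 * iter n extend word_sign w.
Proof.
rewrite [in LHS]iterSr [in LHS]iterSr (eq_iter_extend _ extend2_word_sign).
by rewrite iter_extend_comb -iterSr mulNr.
Qed.

Local Open Scope nat_scope.

(** * Fillings built step by step, and their words *)

Definition has_one (T : filling) j := has (fun r : bitseq => nth false r j) T.
Definition row_restricts j (r : bitseq) :=
  [&& j < size r, ~~ nth false r j & has id (take j r)].
Definition column_word c (T : filling) : seq column_state :=
  mkseq (fun j => (has_one T j, has (row_restricts j) T)) c.

Lemma mem_allowed_rows w r : (r \in allowed_rows w) =
  (size r == size w) && [forall j : 'I_(size w), nth false r j ==> ~~ (nth fresh w j).2].
Proof.
elim: w r => [|x w IHw] [|b r] //=.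
- by apply/esym/forallP => -[].
- rewrite mem_cat; apply/negbTE/norP; split; first by apply/mapP => -[].
  by case: ifP => // _; apply/mapP => -[].
rewrite mem_cat eqSS.
have -> : ([forall j : 'I_(size w).+1,
      nth false (b :: r) j ==> ~~ (nth fresh (x :: w) j).2])
   = (b ==> ~~ x.2) && [forall j : 'I_(size w), nth false r j ==> ~~ (nth fresh w j).2].
  apply/forallP/andP => [H|[H0 /forallP H] j].
    by split; [exact: (H ord0) | apply/forallP => j; exact: (H (lift ord0 j))].
  by case: (unliftP ord0 j) => [k|] -> //=; apply: H.
have memF b' b1 : (b1 :: r \in map (cons b') (allowed_rows w)) =
    (b1 == b') && (r \in allowed_rows w).
  apply/mapP/andP => [[r' r'w [-> ->]]|[/eqP-> rw]]; first by [].
  by exists r.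
by rewrite memF; case: x.2 => //=; rewrite ?memF IHw; case: b => //=; rewrite ?andbF ?orbF.
Qed.

Lemma uniq_allowed_rows w : uniq (allowed_rows w).
Proof.
elim: w => //= x w IHw.
have consI b' : injective (cons b' : bitseq -> bitseq) by move=> r1 r2 [].
rewrite cat_uniq map_inj_uniq // IHw /=; case: x.2 => //=.
rewrite map_inj_uniq // IHw andbT.
by apply/hasPn => r /mapP[r' _ ->]; apply/mapP => -[].
Qed.

Lemma size_add_row l w r : size r = size w -> size (add_row l w r) = size w.
Proof. by elim: w l r => [|x w IHw] l [|b r] //= [/IHw->]. Qed.

Lemma nth_add_row l w r j : size r = size w -> j < size w ->
  nth fresh (add_row l w r) j = ((nth fresh w j).1 || nth false r j,
    (nth fresh w j).2 || ~~ nth false r j && (l || has id (take j r))).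
Proof.
elim: w l r j => [|x w IHw] l [|b r] // [|j] /=; first by rewrite orbF.
by case=> eq_sz lt_j; rewrite IHw // -orbA.
Qed.

Lemma column_word_row r T :
  column_word (size r) (r :: T) = add_row false (column_word (size r) T) r.
Proof.
have sz U : size (column_word (size r) U) = size r by rewrite size_mkseq.
apply: (@eq_from_nth _ fresh) => [|j]; first by rewrite size_add_row !sz.
rewrite sz => lt_j; rewrite nth_add_row ?sz // !nth_mkseq //=.
by rewrite /row_restricts lt_j /= orbC; congr (_, _); rewrite orbC.
Qed.

Lemma column_word_fresh c T : all (fun r => size r <= c) T ->
  column_word c.+1 T = rcons (column_word c T) fresh.
Proof.
move=> /allP leT; rewrite /column_word mkseqS; congr (rcons _ (_, _)).
  by apply/hasPn => r /leT le_r; rewrite nth_default.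
by apply/hasPn => r /leT le_r; rewrite /row_restricts ltnNge le_r.
Qed.

(* [wf c T]: [T] fits in [c] columns, some possibly of height zero on the    *)
(* right, and satisfies all tableau conditions but the one-per-column one.    *)
Fixpoint wf c (T : filling) := if T is r :: T' then
    [&& size r <= c, r \in allowed_rows (column_word (size r) T') & wf (size r) T']
  else true.

Lemma wf_all_size c T : wf c T -> all (fun r => size r <= c) T.
Proof.
elim: T c => //= r T IHT c /and3P[le_rc _ /IHT leT]; rewrite le_rc /=.
by apply: sub_all leT => r' /leq_trans->.
Qed.

(** The column count is stored because columns still empty on the right leave no trace in the
    filling. *)
Fixpoint build n : seq (nat * filling) :=
  if n is n'.+1 then
    [seq (x.1.+1, x.2) | x <- build n'] ++
    [seq (x.1, r :: x.2) | x <- build n', r <- allowed_rows (column_word x.1 x.2)]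
  else [:: (0, [::])].

(** The last step can be read off: it added a row exactly when the top row has length [c]. *)
Lemma mem_build n c T : ((c, T) \in build n) = (c + size T == n) && wf c T.
Proof.
elim: n c T => [|n IHn] c T.
  by rewrite mem_seq1 /= xpair_eqE addn_eq0 size_eq0 -andbA; case: T; rewrite ?andbT.
rewrite mem_cat; apply/orP/andP.
  case=> [/mapP[[c' T'] + [-> ->]]|/allpairsPdep[[c' T'] [r [+ + [-> ->]]]]] /=.
    rewrite IHn => /andP[/eqP<- wfT]; split; first by rewrite addSn.
    by case: (T') wfT => //= r T'' /and3P[/leqW-> -> ->].
  rewrite IHn => /andP[/eqP<- wfT] rT; split; first by rewrite addnS.
  move: (rT); rewrite mem_allowed_rows size_mkseq => /andP[/eqP sz_r _].
  by rewrite sz_r leqnn rT.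
(* The default [c.+1] sends the filling without rows to the column case. *)
case=> szT wfT; have [eq_c|ne_c] := eqVneq (head c.+1 (shape T)) c.
  right; apply/allpairsPdep; case: T eq_c szT wfT => /= [/eqP|r T].
    by rewrite -[X in _ == X]addn0 -addn1 eqn_add2l.
  move=> <-; rewrite addnS eqSS => szT /and3P[_ rT wfT].
  by exists (size r, T), r; rewrite IHn szT wfT.
left; apply/mapP; case: c szT wfT ne_c => [|c] szT wfT ne_c.
  case: T szT wfT ne_c => //= r T _ /and3P[].
  by rewrite leqn0 => ->.
exists (c, T); rewrite // IHn -eqSS -addSn szT.
case: T wfT ne_c {szT} => //= r T /and3P[le_r -> ->] ne_r.
by rewrite !andbT -ltnS ltn_neqAle ne_r.
Qed.

Lemma uniq_build n : uniq (build n).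
Proof.
elim: n => //= n IHn; rewrite cat_uniq map_inj_uniq ?IHn => [|[c T] [c' T'] [-> ->]] //=.
apply/andP; split.
  apply/hasPn => _ /allpairsPdep[[c T] [r [_ + ->]]] /=.
  rewrite mem_allowed_rows size_mkseq => /andP[/eqP sz_r _].
  apply/mapP => -[[c' T'] + [eq_c eqT]]; rewrite mem_build -eqT /= sz_r eq_c.
  by rewrite ltnn andbF.
apply: allpairs_uniq_dep => // [x _|]; first exact: uniq_allowed_rows.
by move=> [[c T] r] [[c' T'] r'] _ _ /= [-> -> ->].
Qed.

Lemma sum_build (F : seq column_state -> int) n :
  (\sum_(x <- build n) F (column_word x.1 x.2) = iter n extend F [::])%R.
Proof.
elim: n F => [|n IHn] F; first by rewrite big_seq1.
rewrite iterSr -IHn /= big_cat big_map big_allpairs_dep /= -big_split /=.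
apply: eq_big_seq => -[c T]; rewrite mem_build => /andP[_ wfT].
rewrite /extend -column_word_fresh ?wf_all_size //=; congr (_ + _)%R.
apply: eq_big_seq => r; rewrite mem_allowed_rows size_mkseq => /andP[/eqP<- _].
by rewrite column_word_row.
Qed.

(** * Comparison with permutation tableaux *)

Lemma is_oneE T i j : is_one T i j = nth false (nth [::] T i) j.
Proof.
rewrite /is_one /in_diagram /entry.
have [lt_i|le_i] := ltnP i (size T); last by rewrite !nth_default ?size_map.
rewrite (nth_map [::]) //; case: ltnP => //= le_j.
by rewrite nth_default.
Qed.

Lemma in_diagramE T i j : in_diagram T i j = (j < size (nth [::] T i)).
Proof.
rewrite /in_diagram; have [lt_i|le_i] := ltnP i (size T).
  by rewrite (nth_map [::]).
by rewrite !nth_default ?size_map.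
Qed.

Lemma one_leftE T i j : one_left T i j = has id (take j (nth [::] T i)).
Proof.
apply/existsP/(has_nthP false) => [[k]|[k]].
  rewrite is_oneE => onek; exists k; rewrite ?nth_take //.
  rewrite size_take_min leq_min ltn_ord /=.
  by apply: contraTT onek; rewrite -leqNgt => /(nth_default _) ->.
rewrite size_take_min leq_min => /andP[lt_k _]; rewrite nth_take // => onek.
by exists (Ordinal lt_k); rewrite is_oneE.
Qed.

Lemma column_restricted_zeroE T i j :
  column_restricted_zero T i j = row_restricts j (nth [::] T i).
Proof.
by rewrite /column_restricted_zero /is_zero one_leftE in_diagramE /entry -andbA.
Qed.

Lemma unrestricted_columnE T j :
  unrestricted_column T j = ~~ has (row_restricts j) T.
Proof.
apply/forallP/hasPn => [H r /(nthP [::])[i lt_i <-]|H i].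
  by rewrite -column_restricted_zeroE (H (Ordinal lt_i)).
by rewrite column_restricted_zeroE H ?mem_nth.
Qed.

(** Condition (2) says that no column-restricted zero has a 1 above it; read row by row from the
    bottom, each new row avoids the columns already restricted. *)
Lemma wfP c T : reflect
  (sorted geq (c :: shape T) /\
   forall i j, column_restricted_zero T i j -> ~~ one_above T i j)
  (wf c T).
Proof.
elim: T c => [|r T IHT] c /=.
  left; split=> // i j; rewrite column_restricted_zeroE nth_nil.
  by rewrite /row_restricts.
have above0 j : one_above (r :: T) 0 j = false by apply/existsP => -[[]].
have aboveS i j : one_above (r :: T) i.+1 j = nth false r j || one_above T i j.
  apply/existsP/orP => [[k]|[r_j|/existsP[k onek]]].
  - rewrite is_oneE; case: (unliftP ord0 k) => [k'|] -> /= onek; last by left.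
    by right; apply/existsP; exists k'; rewrite is_oneE.
  - by exists ord0; rewrite is_oneE.
  - by exists (lift ord0 k); move: onek; rewrite !is_oneE.
apply: (iffP and3P) => [[le_rc rT /IHT[sorT ncT]]|[/andP[le_rc sorT] ncT]].
  split=> [|[|i] j]; rewrite ?above0 ?le_rc //.
  rewrite aboveS column_restricted_zeroE /= => res_ij.
  rewrite negb_or [X in _ && X]ncT ?column_restricted_zeroE // andbT.
  (* The word tested by [r] only covers the columns of [r]; the rows below are no longer than [r],
     so their restricted zeros lie there. *)
  have lt_j : j < size r.
    have /and3P[lt_j _ _] := res_ij; apply: leq_trans lt_j _.
    have [lt_i|/(nth_default [::])->//] := ltnP i (size T).
    have /wf_all_size/allP := introT (IHT _) (conj sorT ncT).
    by apply; rewrite mem_nth.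
  move: rT; rewrite mem_allowed_rows size_mkseq => /andP[_ /forallP/(_ (Ordinal lt_j))].
  rewrite nth_mkseq //= implybN => /implyP; apply.
  apply/hasP; exists (nth [::] T i) => //; rewrite mem_nth // ltnNge.
  by apply/negP => /(nth_default [::]) defT; rewrite defT in res_ij.
split=> //; last first.
  apply/IHT; split=> // i j res_ij.
  by have := ncT i.+1 j; rewrite aboveS negb_or => /(_ res_ij)/andP[].
rewrite mem_allowed_rows size_mkseq eqxx /=; apply/forallP => -[j lt_j] /=.
rewrite nth_mkseq //= implybN; apply/implyP => /hasP[_ /(nthP [::])[i lt_i <-] res_ij].
have := ncT i.+1 j; rewrite aboveS column_restricted_zeroE negb_or.
by case/(_ res_ij)/andP.
Qed.

Definition complete c T := all (has_one T) (iota 0 c).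

Lemma has_oneP T j :
  reflect (exists i : 'I_(nrows T), is_one T i j) (has_one T j).
Proof.
apply: (iffP (has_nthP [::])) => [[i lt_i onei]|[i]].
  by exists (Ordinal lt_i); rewrite is_oneE.
by rewrite is_oneE; exists i.
Qed.

Lemma permutation_tableauE T :
  permutation_tableau T = wf (ncols T) T && complete (ncols T) T.
Proof.
have -> : complete (ncols T) T =
    [forall j : 'I_(ncols T), exists i : 'I_(nrows T), is_one T i j].
  apply/allP/forallP => [H j|H j].
    by apply/existsP/has_oneP; rewrite H // mem_iota add0n ltn_ord.
  by rewrite mem_iota => lt_j; apply/has_oneP/existsP/(H (Ordinal lt_j)).
rewrite /permutation_tableau andbCA [RHS]andbC; congr (_ && _).
have sorE : sorted geq (ncols T :: shape T) = is_ferrers T.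
  by rewrite /ncols /is_ferrers; case: T => //= r T; rewrite leqnn.
apply/andP/wfP => [[ferT /forallP ncT]|[sorT ncT]]; rewrite ?sorE //; last first.
  rewrite -sorE; split=> //; apply/forallP => i; apply/forallP => j.
  apply/implyP => zij; rewrite negb_and orbC -implybE; apply/implyP => lij.
  by apply: ncT; rewrite /column_restricted_zero zij.
split=> // i j /andP[zij lij].
(* A zero lies in the diagram, which bounds both of its indices. *)
have /andP[dij _] := zij.
have lt_i : i < nrows T.
  by rewrite ltnNge; apply: contraL dij => le_i; rewrite in_diagramE nth_default.
have lt_j : j < ncols T.
  rewrite in_diagramE in dij; apply: leq_trans dij _.
  have : sorted geq (ncols T :: shape T) by rewrite sorE.
  move=> /(order_path_min (rev_trans leq_trans))/allP; apply.
  by rewrite map_f // mem_nth.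
move/forallP/(_ (Ordinal lt_j))/implyP/(_ zij): (ncT (Ordinal lt_i)).
by rewrite lij andbT.
Qed.

Lemma urcE T : urc T = count (unrestricted_column T) (iota 0 (ncols T)).
Proof.
by rewrite /urc cardsE cardE size_filter -val_enum_ord count_map -enumT.
Qed.

Lemma word_sign_column_word c T : word_sign (column_word c T) =
  (if complete c T then (-1) ^+ count (unrestricted_column T) (iota 0 c) else 0)%R.
Proof.
rewrite /word_sign big_map /complete.
elim: (iota 0 c) => [|j js IHjs]; first by rewrite big_nil.
rewrite big_cons IHjs /= /col_sign unrestricted_columnE /=.
case: has_one; rewrite /= ?mul0r //; case: (all _ _); rewrite ?mulr0 //.
by case: has; rewrite /= ?mul1r // exprS.
Qed.

(** A one in the last column means that some row has at least [c] cells, and the top row is the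
    longest. *)
Lemma complete_ncols c T : wf c T -> complete c T -> ncols T = c.
Proof.
case: c => [|c] wfT.
  by case: T wfT => // r T /and3P[]; rewrite leqn0 => /eqP.
move/allP/(_ c); rewrite mem_iota ltnSn => /(_ isT)/hasP[r rT r_c].
have lt_c : c < size r by apply: contraTT r_c; rewrite -leqNgt => /(nth_default _)->.
case: T wfT rT => //= r' T /and3P[le_r' _ /wf_all_size/allP le_T].
rewrite inE => rT; apply/eqP; rewrite /ncols /= eqn_leq le_r' /= (leq_trans lt_c) //.
by case/predU1P: rT => [->|/le_T].
Qed.

(** [word_sign] vanishes on incomplete fillings, and for complete ones [c] is determined by the
    filling, so [g] matches tableaux with the remaining terms of [build n]. *)
Lemma s_extend n : s n = iter n extend word_sign [::].
Proof.
rewrite -sum_build.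
under eq_bigr do rewrite word_sign_column_word.
rewrite -big_mkcond /= -big_filter /s.
pose g (U : bounded_filling n) := (ncols (rows U), rows U).
have perm_g : perm_eq (map g (enum (PT n)))
                      [seq x <- build n | complete x.1 x.2].
  apply: uniq_perm; rewrite ?filter_uniq ?uniq_build //.
    by rewrite map_inj_uniq ?enum_uniq // => U V [_ /rows_inj].
  move=> [c T]; rewrite mem_filter mem_build /=; apply/mapP/and3P.
    case=> U; rewrite mem_enum inE permutation_tableauE => /andP[/andP[? ?] lenU].
    by case=> -> ->; rewrite addnC.
  case=> compT lenT wfT; have eq_c := complete_ncols wfT compT.
  have [||U PT_U defT] := @PT_complete n T.
  - by rewrite permutation_tableauE eq_c wfT.
  - by rewrite /tlength eq_c addnC; apply/eqP.
  by exists U; rewrite ?mem_enum // /g defT eq_c.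
rewrite -(perm_big _ perm_g) big_map big_enum /=.
by apply: eq_bigr => U _; rewrite urcE.
Qed.

Local Open Scope ring_scope.

Theorem theorem1p3 (n : nat) (hn : (3 <= n)%N) :
  s n = 2 * s (n - 1)%N - 2 * s (n - 2)%N.
Proof.
case: n hn => [|[|n]] // _; rewrite !s_extend iter_extend_rec.
by rewrite !subSS !subn0.
Qed.
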